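(* For all $n,N\in\mathbb{N}\cup\{0\}$ and all real $t$ with $|t|<1$, \[ \sum_{j=0}^{\infty}t^{j}(j+1)^{n+N}=(1-t)^{-n}\sum_{i=1}^{N+1}a_{i-1}(N,t)\,(1-t)^{-i}\,A_n^{(i)}(t). \]
   Context: For a positive integer $m$, the higher-order Eulerian polynomials $A_n^{(m)}(t)$ are defined by $\left(\dfrac{1-t}{e^{x(t-1)}-t}\right)^{m}=\sum_{n\ge 0}A_n^{(m)}(t)\dfrac{x^n}{n!}$. The coefficients $a_i(N,t)$, for integers $N\ge 0$ and $0\le i\le N$, are defined by $a_0(N,t)=1$ for all $N\ge0$ and $a_i(N,t)=i\,t\sum_{j=0}^{N-i}(i+1)^{j}a_{i-1}(N-j-1,t)$ for $1\le i\le N$. *)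

(* Defs.v *)
From Stdlib Require Import Reals Lra Lia Arith.
From Coquelicot Require Import Coquelicot.
Open Scope R_scope.

(** Formal power series over [R] are coefficient sequences [nat -> R], with
    Coquelicot's [PS_mult] (Cauchy product), [PS_minus] and [PS_scal]. *)

Definition ps_const (c : R) : nat -> R :=
  fun n => match n with O => c | S _ => 0 end.

Fixpoint ps_pow (a : nat -> R) (m : nat) : nat -> R :=
  match m with
  | O => ps_const 1
  | S m' => PS_mult a (ps_pow a m')
  end.

(* [ps_inv_upto a n] agrees with the reciprocal of [a] on the indices [<= n];
   its values beyond [n] are meaningless. *)
Fixpoint ps_inv_upto (a : nat -> R) (n : nat) : nat -> R :=
  match n with
  | O => fun _ => / a O
  | S n' => fun k =>
      if (k <=? n')%nat then ps_inv_upto a n' k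
      else - / a O *
           sum_f_R0 (fun j => a (S j) * ps_inv_upto a n' (n' - j)%nat) n'
  end.

Definition ps_inv (a : nat -> R) : nat -> R := fun n => ps_inv_upto a n n.

Lemma ps_inv_upto_stable (a : nat -> R) (n k : nat) :
  (k <= n)%nat -> ps_inv_upto a n k = ps_inv a k.
Proof.
induction n as [|n IH]; intros Hk.
- now replace k with O by lia.
- destruct (Nat.eq_dec k (S n)) as [->|Hne]; [reflexivity|].
  simpl. replace (k <=? n)%nat with true by (symmetry; apply Nat.leb_le; lia).
  apply IH; lia.
Qed.

Lemma ps_inv_correct (a : nat -> R) (n : nat) :
  a O <> 0 -> PS_mult a (ps_inv a) n = ps_const 1 n.
Proof.
intros Ha; unfold PS_mult; destruct n as [|n].
- unfold ps_inv; simpl; field; exact Ha.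
- rewrite decomp_sum by lia.
  replace (S n - 0)%nat with (S n) by lia.
  assert (E : ps_inv a (S n) = - / a O *
            sum_f_R0 (fun j => a (S j) * ps_inv a (n - j)%nat) n).
  { unfold ps_inv at 1; cbn [ps_inv_upto].
    replace (S n <=? n)%nat with false by (symmetry; apply Nat.leb_gt; lia).
    f_equal; apply sum_eq; intros j Hj.
    rewrite ps_inv_upto_stable by lia; reflexivity. }
  rewrite E; simpl.
  field; exact Ha.
Qed.

(* The series in [x] of [exp (c * x)]. *)
Definition ps_exp (c : R) : nat -> R := fun k => c ^ k / INR (fact k).

(** [eulerian m n t] is the value at [t] of the order-[m] Eulerian polynomial
    of index [n]: [n!] times the coefficient of [x^n] in
    [((1 - t) / (exp (x (t - 1)) - t)) ^ m].  The denominator has constant term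
    [1 - t], so the quotient is meaningful for [t <> 1] only. *)
Definition eulerian (m n : nat) (t : R) : R :=
  INR (fact n) *
  ps_pow (PS_scal (1 - t) (ps_inv (PS_minus (ps_exp (t - 1)) (ps_const t)))) m n.

(* Meaningful for [i <= N] only, where every truncated subtraction is exact and
   the recursion stays in that range. *)
Fixpoint acoef (i N : nat) (t : R) : R :=
  match i with
  | O => 1
  | S i' =>
      INR i * t *
      sum_n (fun j => (INR i + 1) ^ j * acoef i' (N - j - 1) t) (N - i)
  end.

(* Main.v *)
(** Put [h = 1 / (exp ((t - 1) x) - t)], so that the generating function of the
    order-[i] Eulerian polynomials is [((1 - t) h) ^ i].  Expanding geometrically,
    [h = sum_j t^j exp ((j + 1) (1 - t) x)], so the coefficients of [h] are the
    series [sum_j t^j (j + 1)^n] up to [(1 - t)^n / n!].  On the other hand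
    [h' = (1 - t) (h + t h^2)] gives
    [(h^i)' = i (1 - t) (h^i + t h^(i+1))], whence by induction on [N] the
    [N]-th derivative of [h] is [(1 - t)^N sum_i a_(i-1)(N, t) h^i].
    Comparing coefficients of [x^n] yields the identity. *)

Require Import Defs.
From Stdlib Require Import Reals Lra Lia Arith FunctionalExtensionality.
From Coquelicot Require Import Coquelicot.
Open Scope R_scope.

(** * The commutative ring of formal power series *)

Local Notation PS_shift a := (fun k : nat => a (S k)).
Definition PS_add (a b : nat -> R) : nat -> R := fun n => a n + b n.
Definition PS_sub (a b : nat -> R) : nat -> R := fun n => a n - b n.
Definition PS_neg (a : nat -> R) : nat -> R := fun n => - a n.

Lemma PS_mult_0 (a b : nat -> R) : PS_mult a b O = a O * b O.
Proof. reflexivity. Qed.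

Lemma PS_mult_S (a b : nat -> R) (n : nat) :
  PS_mult a b (S n) = a O * b (S n) + PS_mult (PS_shift a) b n.
Proof. unfold PS_mult; rewrite decomp_sum by lia; reflexivity. Qed.

Lemma sum_f_R0_rev (u : nat -> R) (n : nat) :
  sum_f_R0 (fun k => u (n - k)%nat) n = sum_f_R0 u n.
Proof.
induction n as [|n IH]; [reflexivity|].
rewrite decomp_sum by lia; simpl pred.
rewrite (sum_eq _ (fun k => u (n - k)%nat)) by (intros; f_equal; lia).
rewrite IH, tech5, Nat.sub_0_r; ring.
Qed.

Lemma PS_mult_comm (a b : nat -> R) : PS_mult a b = PS_mult b a.
Proof.
apply functional_extensionality; intros n; unfold PS_mult.
rewrite <- (sum_f_R0_rev (fun k => b k * a (n - k)%nat)).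
apply sum_eq; intros k Hk; replace (n - (n - k))%nat with k by lia; ring.
Qed.

Lemma PS_mult_add_l (a b c : nat -> R) :
  PS_mult (PS_add a b) c = PS_add (PS_mult a c) (PS_mult b c).
Proof.
apply functional_extensionality; intros n; unfold PS_add, PS_mult.
rewrite <- sum_plus; apply sum_eq; intros k _; ring.
Qed.

Lemma PS_mult_const_l (c : R) (a : nat -> R) (n : nat) :
  PS_mult (ps_const c) a n = c * a n.
Proof.
destruct n as [|n]; [reflexivity|].
rewrite PS_mult_S; unfold PS_mult; cbn [ps_const].
rewrite sum_eq_R0 by (intros; ring); ring.
Qed.

Lemma PS_mult_scal_l (x : R) (a b : nat -> R) (n : nat) :
  PS_mult (fun k => x * a k) b n = x * PS_mult a b n.
Proof.
unfold PS_mult; rewrite scal_sum; apply sum_eq; intros k _; ring.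
Qed.

(** Induction on the index with [a] general: shifting [PS_mult a b] gives [a O] times the shift of
    [b], plus the shift of [a] times [b], so coefficient [S n] reduces to coefficient [n] for the
    shifted [a]. *)
Lemma PS_mult_assoc (a b c : nat -> R) :
  PS_mult a (PS_mult b c) = PS_mult (PS_mult a b) c.
Proof.
apply functional_extensionality; intros n; revert a; induction n as [|n IH]; intros a.
- rewrite !PS_mult_0; ring.
- rewrite !PS_mult_S, IH.
  replace (PS_shift (PS_mult a b))
    with (PS_add (fun k => a O * b (S k)) (PS_mult (PS_shift a) b))
    by (apply functional_extensionality; intros k; rewrite PS_mult_S; reflexivity).
  rewrite PS_mult_add_l; unfold PS_add.
  rewrite PS_mult_scal_l, PS_mult_0; ring.
Qed.

(** Stated for Leibniz equality, so that [ring] proves identities between whole series, which can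
    then be used for rewriting. *)
Lemma PS_ring_theory :
  ring_theory (ps_const 0) (ps_const 1) PS_add PS_mult PS_sub PS_neg eq.
Proof.
constructor; intros; try (apply functional_extensionality; intros n);
  try (unfold PS_add, PS_sub, PS_neg).
- destruct n; simpl; ring.
- ring.
- ring.
- rewrite PS_mult_const_l; ring.
- exact (f_equal (fun f => f n) (PS_mult_comm x y)).
- exact (f_equal (fun f => f n) (PS_mult_assoc x y z)).
- exact (f_equal (fun f => f n) (PS_mult_add_l x y z)).
- ring.
- destruct n; simpl; ring.
Qed.

Add Ring PS_ring : PS_ring_theory.

(** * Formal differentiation *)

Lemma PS_derive_mult (a b : nat -> R) :
  PS_derive (PS_mult a b) =
  PS_add (PS_mult (PS_derive a) b) (PS_mult a (PS_derive b)).
Proof.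
apply functional_extensionality; intros n.
unfold PS_derive at 1; unfold PS_mult at 1; unfold PS_add.
rewrite scal_sum.
(* The factor [S n] splits as [k + (S n - k)] inside the convolution. The first sum then loses its
   term at [k = 0], the second its term at [k = S n]. *)
transitivity (sum_f_R0 (fun k => INR k * a k * b (S n - k)%nat) (S n)
  + sum_f_R0 (fun k => a k * (INR (S n - k) * b (S n - k)%nat)) (S n)).
{ rewrite <- sum_plus; apply sum_eq; intros k Hk.
  rewrite minus_INR by lia; ring. }
rewrite decomp_sum by lia; rewrite (tech5 _ n).
replace (S n - S n)%nat with O by lia; simpl (INR 0).
replace (pred (S n)) with n by lia.
unfold PS_mult, PS_derive; simpl.
assert (E : sum_f_R0 (fun k => a k * (INR (S n - k) * b (S n - k)%nat)) n =
  sum_f_R0 (fun k => a k * (INR (S (n - k)) * b (S (n - k)))) n).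
{ apply sum_eq; intros k Hk; replace (S n - k)%nat with (S (n - k)) by lia; reflexivity. }
simpl in E; rewrite E; ring.
Qed.

Lemma PS_derive_const (c : R) : PS_derive (ps_const c) = ps_const 0.
Proof.
apply functional_extensionality; intros [|n]; unfold PS_derive; simpl; ring.
Qed.

Lemma PS_derive_exp (c : R) :
  PS_derive (ps_exp c) = PS_mult (ps_const c) (ps_exp c).
Proof.
apply functional_extensionality; intros n.
rewrite PS_mult_const_l; unfold PS_derive, ps_exp.
rewrite fact_simpl, mult_INR; simpl pow; field.
split; [apply INR_fact_neq_0 | apply not_0_INR; lia].
Qed.

Lemma PS_derive_sub (a b : nat -> R) :
  PS_derive (PS_sub a b) = PS_sub (PS_derive a) (PS_derive b).
Proof.
apply functional_extensionality; intros n.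
unfold PS_derive, PS_sub; ring.
Qed.

Lemma ps_pow_scal (c : R) (a : nat -> R) (m n : nat) :
  ps_pow (PS_scal c a) m n = c ^ m * ps_pow a m n.
Proof.
revert n; induction m as [|m IH]; intros n; simpl; [ring|].
replace (ps_pow (PS_scal c a) m) with (PS_mult (ps_const (c ^ m)) (ps_pow a m))
  by (apply functional_extensionality; intros k; rewrite IH; apply PS_mult_const_l).
replace (@PS_scal R_AbsRing R_NormedModule c a) with (PS_mult (ps_const c) a)
  by (apply functional_extensionality; intros k; apply PS_mult_const_l).
replace (PS_mult (PS_mult (ps_const c) a) (PS_mult (ps_const (c ^ m)) (ps_pow a m)))
  with (PS_mult (ps_const c) (PS_mult (ps_const (c ^ m)) (PS_mult a (ps_pow a m)))) by ring.
rewrite !PS_mult_const_l; ring.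
Qed.

(** * The reciprocal of the denominator and its differential equation *)

(** Written with [PS_sub], the subtraction known to [ring]; it is convertible to the [PS_minus] form
    inside [eulerian]. *)
Definition eulerian_denom (t : R) : nat -> R := PS_sub (ps_exp (t - 1)) (ps_const t).

Lemma ps_inv_mult_l (a : nat -> R) :
  a O <> 0 -> PS_mult (ps_inv a) a = ps_const 1.
Proof.
intros Ha; rewrite PS_mult_comm; apply functional_extensionality; intros n.
now apply ps_inv_correct.
Qed.

Lemma ps_inv_unique (a b : nat -> R) :
  a O <> 0 -> PS_mult a b = ps_const 1 -> ps_inv a = b.
Proof.
intros Ha Hab.
transitivity (PS_mult (ps_inv a) (PS_mult a b)); [rewrite Hab; ring|].
rewrite PS_mult_assoc, ps_inv_mult_l by exact Ha; ring.
Qed.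

(** Differentiating [h a = 1] gives [h' a + h a' = 0]; multiplying by [h] isolates [h']. *)
Lemma PS_derive_inv (a : nat -> R) :
  a O <> 0 ->
  PS_derive (ps_inv a) =
  PS_neg (PS_mult (PS_derive a) (PS_mult (ps_inv a) (ps_inv a))).
Proof.
intros Ha; pose proof (ps_inv_mult_l a Ha) as Hinv.
pose proof (f_equal PS_derive Hinv) as H.
rewrite PS_derive_mult, PS_derive_const in H.
set (h := ps_inv a) in *.
transitivity (PS_mult (PS_derive h) (PS_mult h a)); [rewrite Hinv; ring|].
transitivity (PS_sub
  (PS_mult h (PS_add (PS_mult (PS_derive h) a) (PS_mult h (PS_derive a))))
  (PS_mult (PS_derive a) (PS_mult h h))); [ring|].
rewrite H; ring.
Qed.

Lemma eulerian_denom_0 (t : R) : t <> 1 -> eulerian_denom t O <> 0.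
Proof.
intros Ht; unfold eulerian_denom, PS_sub, ps_exp; simpl; lra.
Qed.

(* The denominator [D] satisfies [D' = (t - 1) (D + t)]; then [h' = - D' h^2]. *)
Lemma PS_derive_inv_denom (t : R) :
  t <> 1 ->
  let h := ps_inv (eulerian_denom t) in
  PS_derive h =
  PS_mult (ps_const (1 - t)) (PS_add h (PS_mult (ps_const t) (PS_mult h h))).
Proof.
intros Ht h; unfold h; rewrite PS_derive_inv by now apply eulerian_denom_0.
pose proof (ps_inv_mult_l _ (eulerian_denom_0 t Ht)) as Hinv; fold h in Hinv |- *.
assert (HD : PS_derive (eulerian_denom t) =
  PS_neg (PS_mult (ps_const (1 - t)) (PS_add (eulerian_denom t) (ps_const t)))).
{ unfold eulerian_denom; rewrite PS_derive_sub, PS_derive_exp, PS_derive_const.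
  replace (ps_const (t - 1)) with (PS_neg (ps_const (1 - t)))
    by (apply functional_extensionality; intros [|k]; unfold PS_neg; simpl; ring).
  ring. }
rewrite HD.
transitivity (PS_mult (ps_const (1 - t))
  (PS_add (PS_mult h (PS_mult h (eulerian_denom t)))
          (PS_mult (ps_const t) (PS_mult h h)))); [ring|].
rewrite Hinv; ring.
Qed.

Lemma ps_pow_inv_denom_S (t : R) (i n : nat) :
  t <> 1 ->
  let h := ps_inv (eulerian_denom t) in
  INR (S n) * ps_pow h i (S n) =
  INR i * (1 - t) * (ps_pow h i n + t * ps_pow h (S i) n).
Proof.
intros Ht h.
assert (H : PS_derive (ps_pow h i) =
  PS_mult (ps_const (INR i)) (PS_mult (ps_const (1 - t))
    (PS_add (ps_pow h i) (PS_mult (ps_const t) (ps_pow h (S i)))))).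
{ induction i as [|i IH].
  - simpl ps_pow; rewrite PS_derive_const; change (INR 0) with 0; ring.
  - simpl ps_pow; rewrite PS_derive_mult, IH.
    unfold h at 1; rewrite PS_derive_inv_denom by exact Ht; fold h.
    replace (ps_const (INR (S i))) with (PS_add (ps_const (INR i)) (ps_const 1))
      by (apply functional_extensionality; intros [|k]; rewrite S_INR;
          unfold PS_add; simpl; ring).
    simpl ps_pow; ring. }
(* [INR (S n)] times coefficient [S n] is, by definition, coefficient [n] of the derivative. *)
change (PS_derive (ps_pow h i) n = INR i * (1 - t) * (ps_pow h i n + t * ps_pow h (S i) n)).
rewrite H, !PS_mult_const_l; unfold PS_add.
rewrite PS_mult_const_l; ring.
Qed.

(** * Recursion for the coefficients and the iterated derivative *)

Lemma acoef_S (i N : nat) (t : R) :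
  acoef (S i) N t =
  INR (S i) * t *
  sum_f_R0 (fun j => (INR (S i) + 1) ^ j * acoef i (N - j - 1) t) (N - S i).
Proof. rewrite <- sum_n_Reals; reflexivity. Qed.

(** The term [j = 0] of the defining sum is [acoef i N t]; the other terms are [INR (S i) + 1] times
    the sum for [N]. At [i = N] only the first term exists, which is [acoef_diag]. *)
Lemma acoef_rec (i N : nat) (t : R) :
  (i < N)%nat ->
  acoef (S i) (S N) t =
  (INR (S i) + 1) * acoef (S i) N t + INR (S i) * t * acoef i N t.
Proof.
intros Hi; rewrite !acoef_S.
replace (S N - S i)%nat with (S (N - S i)) by lia.
rewrite decomp_sum by lia; simpl pred.
replace (S N - 0 - 1)%nat with N by lia.
rewrite (sum_eq _ (fun j => (INR (S i) + 1) ^ j * acoef i (N - j - 1) t * (INR (S i) + 1))).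
2: { intros j _; replace (S N - S j - 1)%nat with (N - j - 1)%nat by lia.
     rewrite <- tech_pow_Rmult; ring. }
rewrite <- scal_sum; ring.
Qed.

Lemma acoef_diag (N : nat) (t : R) :
  acoef (S N) (S N) t = INR (S N) * t * acoef N N t.
Proof.
rewrite acoef_S, Nat.sub_diag; cbn [sum_f_R0].
replace (S N - 0 - 1)%nat with N by lia; ring.
Qed.

(** With [p i] standing for [h^(i+1)], the right side is the derivative of the sum for [N], divided
    by [1 - t]. Collecting the multiples of each [p i] gives [acoef_rec] in the middle, [acoef_diag]
    at the top and [a_0 = 1] at the bottom. *)
Lemma sum_acoef_S (N : nat) (t : R) (p : nat -> R) :
  sum_f_R0 (fun i => acoef i (S N) t * p i) (S N) =
  sum_f_R0 (fun i => INR (S i) * acoef i N t * (p i + t * p (S i))) N.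
Proof.
transitivity (sum_f_R0 (fun i => INR (S i) * acoef i N t * p i) N +
  sum_f_R0 (fun i => INR (S i) * t * acoef i N t * p (S i)) N).
2: { rewrite <- sum_plus; apply sum_eq; intros; ring. }
rewrite decomp_sum by lia; simpl pred; destruct N as [|N].
- cbn [sum_f_R0]; rewrite acoef_diag; simpl; ring.
- rewrite (tech5 (fun i => acoef (S i) (S (S N)) t * p (S i)) N), acoef_diag.
  rewrite (decomp_sum (fun i => INR (S i) * acoef i (S N) t * p i)) by lia; simpl pred.
  rewrite (tech5 (fun i => INR (S i) * t * acoef i (S N) t * p (S i)) N).
  rewrite (sum_eq (fun i => acoef (S i) (S (S N)) t * p (S i))
    (fun i => INR (S (S i)) * acoef (S i) (S N) t * p (S i) +
              INR (S i) * t * acoef i (S N) t * p (S i))).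
  2: { intros i Hi; rewrite acoef_rec by lia; rewrite (S_INR (S i)); ring. }
  rewrite sum_plus; change (INR 1) with 1; change (acoef 0 (S (S N)) t) with 1.
  change (acoef 0 (S N) t) with 1; ring.
Qed.

(** The left side is [n!] times coefficient [n] of the [N]-th derivative of [h]. The induction keeps
    [n] general, because one more derivative turns [n] into [S n]. *)
Lemma sum_acoef_pow_inv_denom (n N : nat) (t : R) :
  t <> 1 ->
  let h := ps_inv (eulerian_denom t) in
  INR (fact (n + N)) * h (n + N)%nat =
  (1 - t) ^ N * INR (fact n) *
  sum_f_R0 (fun i => acoef i N t * ps_pow h (S i) n) N.
Proof.
intros Ht h; revert n; induction N as [|N IH]; intros n.
- rewrite Nat.add_0_r; simpl.
  rewrite PS_mult_comm, PS_mult_const_l; ring.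
- replace (n + S N)%nat with (S n + N)%nat by lia.
  rewrite IH, sum_acoef_S, fact_simpl, mult_INR, <- tech_pow_Rmult.
  transitivity ((1 - t) ^ N * INR (fact n) * (INR (S n) *
    sum_f_R0 (fun i => acoef i N t * ps_pow h (S i) (S n)) N)); [ring|].
  replace (INR (S n) * sum_f_R0 (fun i => acoef i N t * ps_pow h (S i) (S n)) N)
    with ((1 - t) * sum_f_R0 (fun i => INR (S i) * acoef i N t *
            (ps_pow h (S i) n + t * ps_pow h (S (S i)) n)) N); [ring|].
  rewrite !scal_sum; apply sum_eq; intros i _.
  pose proof (ps_pow_inv_denom_S t (S i) n Ht) as H; cbv zeta in H; fold h in H.
  transitivity (acoef i N t * (INR (S n) * ps_pow h (S i) (S n))); [rewrite H|]; ring.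
Qed.

(** * The numerical series as coefficients of the reciprocal *)

(** Multiplying by the variable and differentiating turns the coefficients [(j+1)^n] into
    [(j+1)^(n+1)], and both operations preserve the radius. *)
Lemma CV_radius_pow_succ (n : nat) :
  CV_radius (fun j => (INR j + 1) ^ n) = Finite 1.
Proof.
induction n as [|n IH].
- rewrite <- Rinv_1; apply CV_radius_finite_DAlembert; [intros; simpl; lra|lra|].
  apply is_lim_seq_ext with (fun _ => 1); [|apply is_lim_seq_const].
  intros; simpl; rewrite Rdiv_1_r, Rabs_R1; reflexivity.
- rewrite <- IH, <- (CV_radius_incr_1 (fun j => (INR j + 1) ^ n)).
  rewrite <- (CV_radius_derive (PS_incr_1 _)).
  apply CV_radius_ext; intros j.
  unfold PS_derive, PS_incr_1; rewrite S_INR; reflexivity.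
Qed.

Lemma ex_series_pow_succ (t : R) (n : nat) :
  Rabs t < 1 -> ex_series (fun j => t ^ j * (INR j + 1) ^ n).
Proof.
intros Ht; destruct (CV_radius_inside (fun j => (INR j + 1) ^ n) t) as [l Hl].
- rewrite CV_radius_pow_succ; exact Ht.
- exists l; revert Hl; apply is_series_ext; intros j; rewrite pow_n_pow; reflexivity.
Qed.

Lemma is_series_sum_f_R0 (f : nat -> nat -> R) (l : nat -> R) (n : nat) :
  (forall k, (k <= n)%nat -> is_series (f k) (l k)) ->
  is_series (fun j => sum_f_R0 (fun k => f k j) n) (sum_f_R0 l n).
Proof.
induction n as [|n IH]; intros H; simpl; [apply H; lia|].
apply (is_series_plus (fun j => sum_f_R0 (fun k => f k j) n) (f (S n)));
  [apply IH; intros; apply H; lia | apply H; lia].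
Qed.

Definition pow_succ_series (t : R) (n : nat) : R :=
  Series (fun j => t ^ j * (INR j + 1) ^ n).

(* Both sides are the sum of [t ^ j * j ^ n], the left one by expanding
   [j ^ n = ((j + 1) - 1) ^ n]. *)
Lemma pow_succ_series_rec (t : R) (n : nat) :
  Rabs t < 1 ->
  sum_f_R0 (fun k => Binomial.C n k * (-1) ^ k * pow_succ_series t (n - k)) n =
  0 ^ n + t * pow_succ_series t n.
Proof.
intros Ht.
assert (HM : forall m, is_series (fun j => t ^ j * (INR j + 1) ^ m) (pow_succ_series t m))
  by (intros m; apply Series_correct, ex_series_pow_succ, Ht).
transitivity (Series (fun j => t ^ j * INR j ^ n)); [symmetry|]; apply is_series_unique.
- eapply is_series_ext; [|apply (is_series_sum_f_R0
    (fun k j => Binomial.C n k * (-1) ^ k * (t ^ j * (INR j + 1) ^ (n - k))))].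
  + intros j; replace (INR j ^ n) with ((-1 + (INR j + 1)) ^ n) by (f_equal; ring).
    rewrite binomial, scal_sum; apply sum_eq; intros; ring.
  + intros k _; exact (is_series_scal_l (Binomial.C n k * (-1) ^ k) _ _ (HM (n - k)%nat)).
(* The term [j = 0] is [0 ^ n], equal to 1 when [n = 0]; the remaining terms carry a factor [t] and
   the base [j + 1]. *)
- apply is_series_decr_1.
  replace (plus _ _) with (t * pow_succ_series t n) by (unfold plus, opp; simpl; ring).
  eapply is_series_ext; [|exact (is_series_scal_l t _ _ (HM n))].
  intros j; rewrite S_INR; unfold scal; simpl; unfold mult; simpl; ring.
Qed.

(** No geometric expansion of series in [x] is performed: the candidate is multiplied by the
    denominator and recognised through uniqueness of the inverse. [pow_succ_series_rec] leaves only
    [0 ^ m], the coefficients of the series 1. *)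
Lemma ps_inv_denom_series (t : R) (n : nat) :
  Rabs t < 1 ->
  ps_inv (eulerian_denom t) n =
  (1 - t) ^ n / INR (fact n) * pow_succ_series t n.
Proof.
intros Ht; assert (Ht1 : t <> 1) by (apply Rabs_def2 in Ht; lra).
rewrite (ps_inv_unique _
  (fun m => (1 - t) ^ m / INR (fact m) * pow_succ_series t m)
  (eulerian_denom_0 t Ht1)); [reflexivity|].
set (u := fun m => _); apply functional_extensionality; intros m.
transitivity (PS_mult (ps_exp (t - 1)) u m - t * u m).
{ unfold eulerian_denom; rewrite <- PS_mult_const_l.
  replace (PS_mult (PS_sub _ _) u)
    with (PS_sub (PS_mult (ps_exp (t - 1)) u) (PS_mult (ps_const t) u)) by ring.
  reflexivity. }
assert (E : PS_mult (ps_exp (t - 1)) u m = (1 - t) ^ m / INR (fact m) *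
  sum_f_R0 (fun k => Binomial.C m k * (-1) ^ k * pow_succ_series t (m - k)) m).
{ unfold PS_mult; rewrite scal_sum; apply sum_eq; intros k Hk.
  unfold u, ps_exp, Binomial.C.
  replace (t - 1) with (-1 * (1 - t)) by ring; rewrite Rpow_mult_distr.
  replace ((1 - t) ^ m) with ((1 - t) ^ k * (1 - t) ^ (m - k))
    by (rewrite <- pow_add; f_equal; lia).
  field; repeat split; apply INR_fact_neq_0. }
rewrite E, pow_succ_series_rec by exact Ht; unfold u.
destruct m as [|m]; simpl pow; simpl ps_const; [simpl; field|].
field; apply INR_fact_neq_0.
Qed.

(** * Assembling the identity *)

Lemma eulerian_pow_inv_denom (m n : nat) (t : R) :
  eulerian m n t =
  INR (fact n) * ((1 - t) ^ m * ps_pow (ps_inv (eulerian_denom t)) m n).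
Proof. unfold eulerian; rewrite ps_pow_scal; reflexivity. Qed.

Theorem theorem3 (n N : nat) (t : R) (ht : Rabs t < 1) :
  is_series (fun j : nat => t ^ j * (INR j + 1) ^ (n + N))
    (/ (1 - t) ^ n *
     sum_n_m (fun i : nat => acoef (i - 1) N t * / (1 - t) ^ i * eulerian i n t)
       1 (N + 1)).
Proof.
assert (Ht1 : t <> 1) by (apply Rabs_def2 in ht; lra).
assert (Hs : forall k, (1 - t) ^ k <> 0) by (intros k; apply pow_nonzero; lra).
pose proof (Series_correct _ (ex_series_pow_succ t (n + N) ht)) as H.
fold (pow_succ_series t (n + N)) in H.
replace (/ (1 - t) ^ n * _) with (pow_succ_series t (n + N)); [exact H|].
replace (N + 1)%nat with (S N) by lia.
rewrite <- sum_n_m_S.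
change (sum_n_m ?f 0 N) with (sum_n f N); rewrite sum_n_Reals.
(* After the index shift, the factor [(1-t)^(-(i+1))] cancels the [(1-t)^(i+1)] contained in
   [eulerian (S i) n t]. *)
rewrite (sum_eq _ (fun i => acoef i N t *
  ps_pow (ps_inv (eulerian_denom t)) (S i) n * INR (fact n))).
2: { intros i _; rewrite eulerian_pow_inv_denom.
     replace (S i - 1)%nat with i by lia; field; apply (Hs (S i)). }
rewrite <- scal_sum.
pose proof (sum_acoef_pow_inv_denom n N t Ht1) as HT; cbv zeta in HT.
rewrite ps_inv_denom_series in HT by exact ht.
assert (HM : (1 - t) ^ (n + N) * pow_succ_series t (n + N) =
  (1 - t) ^ N * (INR (fact n) *
    sum_f_R0 (fun i => acoef i N t * ps_pow (ps_inv (eulerian_denom t)) (S i) n) N)).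
{ rewrite <- Rmult_assoc, <- HT; field; apply INR_fact_neq_0. }
(* Of this nonzero factor, [(1-t)^n] cancels the prefactor of the claim and [(1-t)^N] is the one
   produced by the [N] derivatives. *)
apply (Rmult_eq_reg_l ((1 - t) ^ (n + N))); [|apply Hs].
rewrite HM, pow_add; field; apply Hs.
Qed.
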